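(* Let $A\in\mathbb C^{N\times N}$ have Jordan decomposition $A=V_AJV_A^{-1}$, let $T$ be an $N\times N$ permutation matrix, and let $B=TAT^{-1}$, taken with the Jordan decomposition $B=V_BJV_B^{-1}$ where $V_B=TV_A$ (so that $\mathcal G(A)$ and $\mathcal G(B)$ are isomorphic). Then the graph Fourier transform is invariant to the choice between $\mathcal G(A)$ and $\mathcal G(B)$ up to a permutation of the signal and the inverse permutation of the transform: for every graph signal $s\in\mathbb C^N$ and all $i,j$, if $\widehat s_{A,ij}$ denotes the $(i,j)$ component of the graph Fourier transform of $s$ over $\mathcal G(A)$ and $\widehat{(Ts)}_{B,ij}$ denotes the $(i,j)$ component of the graph Fourier transform of $Ts$ over $\mathcal G(B)$, then $$\widehat s_{A,ij}=T^{-1}\,\widehat{(Ts)}_{B,ij}.$$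
   Context: $\mathcal G(A)$ is the (weighted, directed) graph with adjacency matrix $A\in\mathbb C^{N\times N}$. Let $A$ have distinct eigenvalues $\lambda_1,\dots,\lambda_k$ with geometric multiplicities $g_1,\dots,g_k$. A Jordan decomposition is $A=VJV^{-1}$, where $J$ is block diagonal with upper triangular Jordan blocks of size $r_{ij}$ for $\lambda_i$ ($i=1,\dots,k$, $j=1,\dots,g_i$) and $V=[V_{11}\cdots V_{1g_1}\cdots V_{k1}\cdots V_{kg_k}]$ is partitioned conformally, $V_{ij}\in\mathbb C^{N\times r_{ij}}$ having as columns a Jordan chain of $\lambda_i$. The Jordan subspaces are $\mathscr J_{ij}=\mathrm{span}\{V_{ij}\}$ (column span), and $\mathbb C^N=\bigoplus_{i,j}\mathscr J_{ij}$. Graph Fourier transform (GFT) of $s\in\mathbb C^N$ over $\mathcal G(A)$ (with the given decomposition): the tuple $(\widehat s_{ij})_{i,j}$ of the unique vectors $\widehat s_{ij}\in\mathscr J_{ij}$ with $s=\sum_{i,j}\widehat s_{ij}$; equivalently $\widehat s_{ij}=V_{ij}W_{ij}^Hs$, where $W=V^{-H}$ is partitioned into column blocks $W_{ij}$ conformally with $V$. Two graphs $\mathcal G(A),\mathcal G(B)$ are isomorphic if $B=TAT^{-1}$ for a permutation matrix $T$; in that case the eigenvector matrices are taken to be related by $V_B=TV_A$. *)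

(* Defs.v *)
From mathcomp Require Import all_boot all_order all_algebra.
From mathcomp Require Import boolp reals.
From mathcomp Require Export complex.

Set Implicit Arguments.
Unset Strict Implicit.
Unset Printing Implicit Defensive.

Import GRing.Theory.
Local Open Scope ring_scope.

Definition jordan_block (F : fieldType) (a : F) (n : nat) : 'M[F]_n :=
  \matrix_(p < n, q < n) (a *+ (p == q) + ((q : nat) == p.+1)%:R).

Record jordan_form (F : fieldType) (N : nat) := JordanForm {
  nb_eig : nat;
  eig : 'I_nb_eig -> F;
  gmult : 'I_nb_eig -> nat;
  bsize : forall i : 'I_nb_eig, 'I_(gmult i) -> nat;
  eig_inj : injective eig;
  bsize_gt0 : forall i j, (0 < @bsize i j)%N;
  sum_bsize : (\sum_(i < nb_eig) \sum_(j < gmult i) @bsize i j)%N = N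
}.

Section Jordan.
Variables (F : fieldType) (N : nat).
Implicit Types (A V T : 'M[F]_N) (J : jordan_form F N) (s : 'cV[F]_N).

Definition jordan_mx J : 'M[F]_N :=
  castmx (sum_bsize J, sum_bsize J)
    (\mxdiag_(i < nb_eig J) \mxdiag_(j < gmult i)
       jordan_block (eig i) (bsize j)).

(* [eigenvalue] and [eigenspace] act on row vectors, hence the transposes.    *)
Record jordan_decomposition A V J : Prop := JordanDecomposition {
  jordan_eig : forall a, eigenvalue A^T a <-> exists i : 'I_(nb_eig J), a = eig i;
  jordan_gmult : forall i : 'I_(nb_eig J),
    gmult i = \rank (eigenspace A^T (eig i));
  jordan_unit : V \in unitmx;
  jordan_eq : A = V *m jordan_mx J *m invmx V
}.

Definition jordan_cols J V (i : 'I_(nb_eig J)) (j : 'I_(gmult i)) :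
    'M[F]_(N, bsize j) :=
  submxrow (submxrow (castmx (erefl N, esym (sum_bsize J)) V) i) j.

Definition jordan_subspace J V (i : 'I_(nb_eig J)) (j : 'I_(gmult i)) :
    {vspace 'cV[F]_N} :=
  <<[seq col p (jordan_cols V j) | p : 'I_(bsize j)]>>%VS.

Definition is_gft J V s
    (shat : forall i : 'I_(nb_eig J), 'I_(gmult i) -> 'cV[F]_N) : Prop :=
  (forall i (j : 'I_(gmult i)), shat i j \in jordan_subspace V j) /\
  s = \sum_i \sum_j shat i j.

Lemma mem_jordan_subspace J V (i : 'I_(nb_eig J)) (j : 'I_(gmult i)) v :
  v \in jordan_subspace V j <-> exists c, v = jordan_cols V j *m c.
Proof.
have colsE c : jordan_cols V j *m c =
    \sum_p c p 0 *: col p (jordan_cols V j).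
  apply/matrixP => a b; rewrite !mxE summxE; apply: eq_bigr => p _.
  by rewrite !mxE (ord1 b) mulrC.
split=> [|[c ->]]; last first.
  rewrite colsE; apply: rpred_sum => p _; apply/rpredZ/memv_span.
  by apply/mapP; exists p; rewrite ?mem_enum.
pose M := jordan_cols V j; pose f := linfun (mulmx M : 'cV_(bsize j) -> 'cV_N).
suff /subvP sub : (jordan_subspace V j <= limg f)%VS.
  by move=> /sub /memv_imgP[c _ ->]; exists c; rewrite lfunE.
apply/span_subvP => _ /mapP[p _ ->].
by apply/memv_imgP; exists (delta_mx p 0); rewrite ?memvf // lfunE /= -colE.
Qed.

(* The right-hand side is V_ij W_ij^H s: the nested submxcol is W_ij^H, the   *)
(* block of rows of V^-1 conformal with V_ij.                                 *)
Lemma is_gftP J V s shat : V \in unitmx ->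
  is_gft V s shat <->
  forall i (j : 'I_(@gmult _ _ J i)), shat i j =
    jordan_cols V j *m
    (submxcol (submxcol (castmx (esym (sum_bsize J), erefl N) (invmx V)) i) j *m s).
Proof.
move=> Vu; set W := castmx _ _; pose V' := castmx (erefl N, esym (sum_bsize J)) V.
have VW : V' *m W = 1%:M.
  rewrite -(mulmxV Vu) /V' /W; case: _ / (esym (sum_bsize J)) => //=.
have WV : W *m V' = 1%:M.
  have : W *m V' = castmx (esym (sum_bsize J), esym (sum_bsize J)) (invmx V *m V).
    by rewrite /V' /W; case: _ / (esym (sum_bsize J)).
  move->; rewrite mulVmx //; by case: _ / (esym (sum_bsize J)).
have sumE (c : 'cV_(\sum_i \sum_j bsize j)) :
    V' *m c = \sum_i \sum_j jordan_cols V j *m submxcol (submxcol c i) j.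
  rewrite -{1}[V']submxrowK -{1}[c]submxcolK mul_mxrow_mxcol.
  apply: eq_bigr => i _.
  by rewrite -{1}[submxrow V' i]submxrowK -{1}[submxcol c i]submxcolK mul_mxrow_mxcol.
have ssub (i : 'I_(nb_eig J)) (j : 'I_(gmult i)) (c : 'cV_N) :
    submxcol (submxcol W i) j *m c = submxcol (submxcol (W *m c) i) j.
  by rewrite !submxcol_mul.
split=> [[shatV ->] i j|shatE]; last first.
  split=> [i j|]; first by apply/mem_jordan_subspace; rewrite shatE; eexists.
  rewrite -[LHS]mul1mx -VW -mulmxA sumE; apply: eq_bigr => i _.
  by apply: eq_bigr => j _; rewrite shatE ssub.
have cP i' (j' : 'I_(gmult i')) := cid ((mem_jordan_subspace V j' _).1 (shatV i' j')).
pose c := \mxcol_i \mxcol_j (projT1 (cP i j)).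
have -> : \sum_i \sum_j shat i j = V' *m c.
  rewrite sumE; apply: eq_bigr => i' _; apply: eq_bigr => j' _.
  by rewrite /c !mxcolK; case: (cP i' j').
rewrite ssub mulmxA WV mul1mx /c !mxcolK.
by case: (cP i j).
Qed.

Lemma gft_subproof A V J (D : jordan_decomposition A V J) s :
  exists shat, @is_gft J V s shat.
Proof. by eexists; apply/(is_gftP _ _ (jordan_unit D)). Qed.

(* The choice made by [cid] is irrelevant, by [gft_unique].                   *)
Definition gft A V J (D : jordan_decomposition A V J) s :
    forall i : 'I_(nb_eig J), 'I_(gmult i) -> 'cV[F]_N :=
  projT1 (cid (gft_subproof D s)).
Arguments gft {A V J} D s i j.

Lemma gftP A V J (D : jordan_decomposition A V J) s : is_gft V s (gft D s).
Proof. by rewrite /gft; case: cid. Qed.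

Lemma gft_unique A V J (D : jordan_decomposition A V J) s shat :
  is_gft V s shat -> forall i j, shat i j = gft D s i j.
Proof.
have Vu := jordan_unit D.
move=> /(is_gftP _ _ Vu) E i j; rewrite E.
by have /(is_gftP _ _ Vu) -> := gftP D s.
Qed.

Lemma jordan_decomposition_perm A V J T : is_perm_mx T ->
  jordan_decomposition A V J ->
  jordan_decomposition (T *m A *m invmx T) (T *m V) J.
Proof.
case/is_perm_mxP => u uE [eigA gmA Vu AE].
have Tu : T \in unitmx by rewrite uE unitmx_perm.
have rk a : \rank (eigenspace (T *m A *m invmx T)^T a) = \rank (eigenspace A^T a).
  rewrite /eigenspace !mxrank_ker; congr (_ - _)%N.
  have -> : (T *m A *m invmx T)^T - a%:M = (T *m (A - a%:M) *m invmx T)^T.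
    rewrite mulmxBr mulmxBl linearB /= scalar_mxC -[a%:M *m T *m _]mulmxA mulmxV // mulmx1.
    by rewrite tr_scalar_mx.
  rewrite mxrank_tr mxrankMfree ?row_free_unit ?unitmx_inv //.
  rewrite eqmxMfull ?row_full_unit // -mxrank_tr linearB /=.
  by rewrite tr_scalar_mx.
split=> [a|i||].
- by rewrite -eigA /eigenvalue -!mxrank_eq0 rk.
- by rewrite rk.
- by rewrite unitmx_mul Tu.
have TVu : T *m V \in unitmx by rewrite unitmx_mul Tu.
have -> : invmx (T *m V) = invmx V *m invmx T.
  apply: (can_inj (mulKmx TVu)); rewrite mulmxV //.
  by rewrite mulmxA mulmxK // mulmxV.
by rewrite AE !mulmxA.
Qed.

End Jordan.

Arguments gft {F N A V J} D s i j.

(* Main.v *)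
Require Import Defs.
From mathcomp Require Import all_boot all_order all_algebra.
From mathcomp Require Import reals complex.

Local Open Scope ring_scope.

(** Since [VB = T *m VA], multiplication by [T] sends each Jordan subspace of [A] into the one of
    [B] with the same indices. Applied to the expansion of [s], it gives an expansion of [T *m s]
    along the subspaces of [B] ([is_gft_mulmx]). Such an expansion is unique ([gft_unique]), so its
    terms are the transform over [B]; cancelling [T] concludes. *)

Lemma jordan_cols_mulmx (F : fieldType) (N : nat) (J : jordan_form F N)
    (T V : 'M[F]_N) (i : 'I_(nb_eig J)) (j : 'I_(gmult i)) :
  jordan_cols (T *m V) j = T *m jordan_cols V j.
Proof.
(* The dimension [m] is kept free so that [e] can be eliminated. *)
have castM m (e : N = m) : castmx (erefl N, e) (T *m V) = T *m castmx (erefl N, e) V.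
  by case: m / e.
by rewrite /jordan_cols castM !mul_submxrow.
Qed.

(** Coordinates are preserved: the vector [c] that expresses a component in the columns of [V]
    expresses its image in those of [T *m V]. *)
Lemma is_gft_mulmx (F : fieldType) (N : nat) (J : jordan_form F N)
    (T V : 'M[F]_N) (s : 'cV[F]_N)
    (shat : forall i : 'I_(nb_eig J), 'I_(gmult i) -> 'cV[F]_N) :
  is_gft V s shat -> is_gft (T *m V) (T *m s) (fun i j => T *m shat i j).
Proof.
case=> shatV ->; split=> [i j|].
  have /mem_jordan_subspace[c ->] := shatV i j.
  by apply/mem_jordan_subspace; exists c; rewrite jordan_cols_mulmx mulmxA.
by rewrite mulmx_sumr; apply: eq_bigr => i _; rewrite mulmx_sumr.
Qed.

Theorem theorem1 (R : realType) (N : nat) (A B VA VB T : 'M[R[i]]_N)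
    (J : jordan_form R[i] N)
    (DA : jordan_decomposition A VA J)
    (hT : is_perm_mx T)
    (hB : B = T *m A *m invmx T)
    (hV : VB = T *m VA)
    (DB : jordan_decomposition B VB J)
    (s : 'cV[R[i]]_N) (i : 'I_(nb_eig J)) (j : 'I_(gmult i)) :
  gft DA s i j = invmx T *m gft DB (T *m s) i j.
Proof.
have Tu : T \in unitmx by case/is_perm_mxP: hT => u ->; exact: unitmx_perm.
have gftT : is_gft VB (T *m s) (fun i j => T *m gft DA s i j).
  by rewrite hV; apply: is_gft_mulmx; exact: gftP.
(* Uniqueness over [B] replaces [gft DB (T *m s) i j] by [T *m gft DA s i j]. *)
by rewrite -(gft_unique DB gftT) mulKmx.
Qed.
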